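(* Let $f(u)=u^3$ and $\eta(u)=u^2+e^u$. Then there exists Riemann initial data $u_0(x)=u_L$ for $x<0$, $u_0(x)=u_R$ for $x>0$, with $u_L,u_R>0$, such that the Cauchy problem for $u_t+(f(u))_x=0$, $t>0$, $x\in\mathbb R$, with initial data $u_0$ has infinitely many distinct $\eta$-entropic solutions.
   Context: A bounded weak solution $u$ of $u_t+(f(u))_x=0$ is called $\eta$-entropic if $(\eta(u))_t+(q(u))_x\le0$ in the sense of distributions on $(0,\infty)\times\mathbb R$, i.e. $\int_0^\infty\int_{\mathbb R}(\psi_t\,\eta(u)+\psi_x\,q(u))\,dx\,dt\ge0$ for all $0\le\psi\in C_c^\infty((0,\infty)\times\mathbb R)$, where $q$ is the entropy flux, $q'=\eta'f'$. Solutions take values in a bounded interval $[-M,M]$ of $\mathbb R$ ($M$ large enough to contain the states involved). *)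

(* Defs.v *)
From HB Require Import structures.
From mathcomp Require Import all_boot all_order all_algebra.
From mathcomp Require Import all_classical all_reals all_analysis.

Set Implicit Arguments.
Unset Strict Implicit.
Unset Printing Implicit Defensive.

Import Order.TTheory GRing.Theory Num.Theory.
Import numFieldNormedType.Exports.

Local Open Scope classical_set_scope.
Local Open Scope ring_scope.

(* Points of the plane are pairs z = (t, x): time first, space second. *)

Definition half_plane (R : realType) : set (R * R) := [set z | 0 < z.1].
Arguments half_plane R : clear implicits.

Definition leb2 (R : realType) :
    {measure set (measurableTypeR R * measurableTypeR R)%type -> \bar R} :=
  (@lebesgue_measure R \x @lebesgue_measure R)%E.
Arguments leb2 R : clear implicits.

Definition dt (R : realType) (phi : R * R -> R) : R * R -> R :=
  'D_((1, 0) : R * R) phi.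

Definition dx (R : realType) (phi : R * R -> R) : R * R -> R :=
  'D_((0, 1) : R * R) phi.

Fixpoint class_C (R : realType) (k : nat) (phi : R * R -> R) : Prop :=
  continuous phi /\
  if k is k'.+1 then
    [/\ forall z, derivable phi z ((1, 0) : R * R),
        forall z, derivable phi z ((0, 1) : R * R),
        class_C k' (dt phi) & class_C k' (dx phi)]
  else True.

(* phi is in C_c^oo(U) for U open, functions on U being extended by 0. *)
Definition test_function (R : realType) (U : set (R * R)) (phi : R * R -> R) :
    Prop :=
  let supp := closure [set z | phi z != 0] in
  [/\ forall k, class_C k phi, compact supp & supp `<=` U].

Definition riemann_data (R : realType) (uL uR : R) (x : R) : R :=
  if x < 0 then uL else uR.

(* u is a weak solution, with values in [-M, M], of u_t + f(u)_x = 0 for t > 0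
   with initial data u0.  The data are attained in the usual weak sense, through
   test functions that need not vanish at t = 0: these are the restrictions to
   t >= 0 of the functions of C_c^oo(R * R).  Only the values of u on the open
   half plane matter. *)
Definition weak_solution (R : realType) (f : R -> R) (M : R) (u0 : R -> R)
    (u : R * R -> R) : Prop :=
  [/\ measurable_fun (half_plane R) u,
      forall z, half_plane R z -> `|u z| <= M &
      forall phi, test_function setT phi ->
        \int[leb2 R]_(z in half_plane R) (dt phi z * u z + dx phi z * f (u z))
        + \int[@lebesgue_measure R]_x (u0 x * phi (0, x)) = 0].

Definition entropy_flux (R : realType) (f eta q : R -> R) : Prop :=
  forall v : R, derivable q v 1 /\ derive1 q v = derive1 eta v * derive1 f v.

(* eta(u)_t + q(u)_x <= 0 in the sense of distributions on the open half plane;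
   q is determined up to a constant, which does not affect the inequality. *)
Definition entropic (R : realType) (f eta : R -> R) (u : R * R -> R) : Prop :=
  exists2 q : R -> R, entropy_flux f eta q &
    forall psi, test_function (half_plane R) psi -> (forall z, 0 <= psi z) ->
      0 <= \int[leb2 R]_(z in half_plane R)
             (dt psi z * eta (u z) + dx psi z * q (u z)).

Definition entropic_solutions (R : realType) (f eta : R -> R) (M : R)
    (u0 : R -> R) : set (R * R -> R) :=
  [set u | weak_solution f M u0 u /\ entropic f eta u].

(* The class of all functions equal to u almost everywhere on the half plane. *)
Definition ae_class (R : realType) (u : R * R -> R) : set (R * R -> R) :=
  [set v | ae_eq (leb2 R) (half_plane R) u v].

(* Main.v *)
Require Import Defs.
From mathcomp Require Import all_boot all_order all_algebra.
From mathcomp Require Import all_classical all_reals all_analysis.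
From mathcomp Require Import measurable_realfun ring lra.

Import Order.TTheory GRing.Theory Num.Theory.
Import numFieldNormedType.Exports.

Local Open Scope classical_set_scope.
Local Open Scope ring_scope.

(* Take u_L = 6 and u_R = 1 and insert a negative intermediate state m: for
   every m in [-8, -15/2] the two jumps 6 -> m and m -> 1 have Rankine-Hugoniot
   speeds 36 + 6 m + m^2 < 1 + m + m^2 and dissipate eta, so each m gives an
   entropic solution made of two shocks.  The term e^u of eta is what makes the
   nonclassical jump 6 -> m admissible: with eta = u^2 alone one would need
   m >= -6, whereas the speeds are ordered only for m < -7.  That these functions
   are weak and entropic solutions follows from the Gauss-Green formula on the
   regions {t > 0, x > s t} with s > 0, which Fubini reduces to the fundamental
   theorem of calculus along the axes. *)

(** * Measurability and integrability on the plane *)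

Lemma open_measurable_prod (R : realType) (U : set (R * R)) :
  open U -> measurable (U : set (measurableTypeR R * measurableTypeR R)%type).
Proof.
move=> oU.
(* Rectangles generate the product sigma-algebra, and only countable unions are available: hence the
   boxes with rational corners contained in [U]. *)
pose box (q : (rat * rat) * (rat * rat)) : set (R * R) :=
  `]ratr q.1.1, ratr q.1.2[%classic `*` `]ratr q.2.1, ratr q.2.2[%classic.
have -> : U = \bigcup_(q in [set q | box q `<=` U]) box q.
  apply/seteqP; split => [[x y] Uxy|z [q + qz]]; last exact.
  have /nbhs_ballP[e /= e0 eU] := open_nbhs_nbhs (conj oU Uxy).
  have lt_e (c : R) : c - e < c /\ c < c + e by split; lra.
  have [/rat_in_itvoo[a] + /rat_in_itvoo[b]] := lt_e x.
  have [/rat_in_itvoo[c] + /rat_in_itvoo[d]] := lt_e y.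
  rewrite !in_itv/= => /andP[c1 c2] /andP[d1 d2] /andP[a1 a2] /andP[b1 b2].
  exists ((a, b), (c, d)) => /=; last first.
    by split; rewrite /= in_itv/= ?a2 ?b1 ?c2 ?d1.
  move=> [v w] [/=]; rewrite !in_itv/= => /andP[v1 v2] /andP[w1 w2].
  by apply: eU; split; rewrite /ball/= ltr_distlC; apply/andP; split; lra.
rewrite bigcup_mkcond; apply: countable_bigcupT_measurable => [|q].
  exact: countableP.
case: ifPn => // _.
by apply: measurableX; exact: measurable_itv.
Qed.

Lemma continuous_measurable_prod (R : realType) (g : R * R -> R) :
  continuous g ->
  measurable_fun setT (g : measurableTypeR R * measurableTypeR R -> R).
Proof.
move=> /continuousP cg.
apply: (measurability (@RGenOpens.G R)).
  exact: RGenOpens.measurableE.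
move=> _ [_ [a [b ->]] <-]; rewrite setTI.
apply: (@open_measurable_prod R (g @^-1` `]a, b[)).
by apply: cg; exact: interval_open.
Qed.

Lemma test_function_support {R : realType} (phi : R * R -> R) :
  test_function setT phi ->
  exists2 B, 0 < B & forall z, (B <= `|z.1|) || (B <= `|z.2|) ->
    [/\ phi z = 0, dt phi z = 0 & dx phi z = 0].
Proof.
move=> [_ /compact_bounded[M [_ hM]] _].
(* Compactness bounds the support by every number above [M], in particular by [|M| + 1]. Beyond
   [|M| + 2] a point is outside the closed support, so [phi] vanishes around it and its derivatives
   vanish too. *)
exists (`|M| + 2) => [|z zB]; first by have := normr_ge0 M; lra.
have zS : ~ closure [set z | phi z != 0] z.
  move=> /(hM (`|M| + 1)).
  have /[swap] /[apply] : M < `|M| + 1 by have := ler_norm M; lra.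
  rewrite /Num.norm/= ge_max => /andP[h1 h2].
  by case/orP : zB; rewrite leNgt => /negP; apply;
    apply: (@le_lt_trans _ _ (`|M| + 1)); rewrite // ltrD2l; lra.
have nz : \near z, phi z = 0.
  have oS : open (~` closure [set z | phi z != 0]).
    exact/closed_openC/closed_closure.
  have := open_nbhs_nbhs (conj oS zS).
  apply: filterS => y /= yS; apply/eqP/negPn/negP => py; apply: yS.
  exact: subset_closure.
split.
- exact: nbhs_singleton nz.
- by rewrite /dt (near_eq_derive _ nz) derive_cst.
- by rewrite /dx (near_eq_derive _ nz) derive_cst.
Qed.

Lemma integrable_compact_support {R : realType} (g : R * R -> R) (B : R) :
  continuous g ->
  (forall z, (B <= `|z.1|) || (B <= `|z.2|) -> g z = 0) ->
  (leb2 R).-integrable setT (EFin \o g).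
Proof.
move=> cg g0.
pose I : set R := `[- B, B]%classic.
pose K : set (R * R) := I `*` I.
have mK : measurable (K : set (measurableTypeR R * measurableTypeR R)%type).
  by apply: measurableX; exact: measurable_itv.
have -> : EFin \o g = (EFin \o g) \_ K.
  apply/funext => z; rewrite patchE; case: ifPn => //= /negP zK.
  rewrite g0//; apply: contraT; rewrite negb_or -!ltNge => /andP[h1 h2].
  by exfalso; apply: zK; rewrite inE; split; rewrite /I/= in_itv/= -ler_norml ltW.
apply: ((integrable_mkcond _ mK).1 _).
apply: measurable_bounded_integrable => //.
- rewrite /leb2/= product_measure1E//=; try exact: measurable_itv.
  by rewrite lte_mul_pinfty// lebesgue_measure_itv/=; case: ifPn => // _;
    rewrite ?ltry.
- by apply: measurable_funTS; apply: continuous_measurable_prod.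
- have : compact (g @` K).
    apply: continuous_compact; first exact: continuous_subspaceT.
    by apply: compact_setX; exact: segment_compact.
  move=> /compact_bounded[M [Mr hM]].
  rewrite /bounded_near; near=> N; move=> z Kz /=; apply: (hM N); last by exists z.
  by near: N; exact: nbhs_pinfty_gt.
Unshelve. all: by end_near. Qed.

(** The integral over a set is that of the extension by zero, and here the two extensions are the
    same function. *)
Lemma integral_support {d} {T : measurableType d} {R : realType}
    (mu : set T -> \bar R) (A B : set T) (f : T -> \bar R) :
  B `<=` A -> (forall x, A x -> ~ B x -> f x = 0%E) ->
  (\int[mu]_(x in A) f x = \int[mu]_(x in B) f x)%E.
Proof.
move=> BA f0; rewrite /integral; suff -> : f \_ A = f \_ B by [].
apply/funext => x; rewrite !patchE.
have [xA|xA] := boolP (x \in A); have [xB|xB] := boolP (x \in B) => //.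
- by apply: f0; [exact: set_mem|move/mem_set; exact/negP].
- by case/negP: xA; exact/mem_set/BA/set_mem.
Qed.

(** * The Gauss-Green formula on {t > 0, x > s t} *)

Section integral_derive1.
Context {R : realType} (F f : R -> R).
Hypotheses (dF : forall x : R, is_derive x 1 F (f x)) (cf : continuous f).
Local Notation mu := (@lebesgue_measure R).

Let cF : continuous F.
Proof. by move=> x; apply/differentiable_continuous/derivable1_diffP/ex_derive. Qed.

Lemma integral_derive1_cc (a b : R) : a <= b ->
  (\int[mu]_(x in `[a, b]) (f x)%:E = (F b - F a)%:E)%E.
Proof.
rewrite le_eqVlt => /predU1P[->|ab]; first by rewrite set_itv1 integral_set1 subrr.
rewrite (continuous_FTC2 ab (F := F))//.
- exact: continuous_subspaceT.
by split; [move=> x _; exact: ex_derive|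
           apply: cvg_at_right_filter; exact: cF|
           apply: cvg_at_left_filter; exact: cF].
- by move=> x _; rewrite derive1E derive_val.
Qed.

Let mf (A : set R) : measurable A -> measurable_fun A (EFin \o f).
Proof.
move=> mA; apply/measurable_EFinP; apply: measurable_funTS.
exact: continuous_measurable_fun.
Qed.

Lemma integral_derive1_oo (a b : R) : a <= b ->
  (\int[mu]_(x in `]a, b[) (f x)%:E = (F b - F a)%:E)%E.
Proof.
by move=> ab; rewrite -integral_derive1_cc// [RHS]integral_itv_bndoo//; exact: mf.
Qed.

Context (B : R).
Hypothesis F0 : forall x, B <= `|x| -> F x = 0 /\ f x = 0.

Lemma integral_derive1_oy (a : R) :
  (\int[mu]_(x in `]a, +oo[) (f x)%:E = (- F a)%:E)%E.
Proof.
(* From [b] on, both [F] and [f] vanish, which reduces the half line to a bounded interval. *)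
pose b := Num.max a `|B|.
have ab : a <= b by rewrite le_max lexx.
have Bb x : b <= x -> B <= `|x|.
  move=> bx; rewrite (le_trans (ler_norm B))// (le_trans _ (ler_norm x))//.
  by rewrite (le_trans _ bx)// le_max lexx orbT.
have -> : (- F a)%:E = (\int[mu]_(x in `]a, b[) (f x)%:E)%E.
  by rewrite integral_derive1_oo// (F0 _ (Bb _ (lexx b))).1 sub0r.
apply: integral_support.
- by move=> x /=; rewrite !in_itv/= andbT => /andP[].
- move=> x /=; rewrite !in_itv/= andbT => -> /negP; rewrite -leNgt => bx.
  by rewrite (F0 _ (Bb _ bx)).2.
Qed.

Lemma integral_derive1_line : (\int[mu]_x (f x)%:E = 0)%E.
Proof.
have B0 : B <= `|B| by exact: ler_norm.
(* This half line carries all of [f], and [F] vanishes at its endpoint. *)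
have -> : 0%E = (\int[mu]_(x in `](- `|B|)%R, +oo[) (f x)%:E)%E.
  by rewrite integral_derive1_oy (F0 _ _).1 ?oppr0// normrN normr_id.
apply: integral_support => //; move=> x _ /=.
rewrite in_itv/= andbT => /negP; rewrite -leNgt => xB.
by rewrite (F0 _ _).2//; have := ler_norm (- x); rewrite normrN; lra.
Qed.

End integral_derive1.

(** Substitution [x = s * t], made on the segments [[0, s * b]] and [[0, b]] outside which the
    integrands vanish. It turns a trace on the line [x = s t] parametrised by [x] into one
    parametrised by time. *)
Lemma Rintegral_dilation {R : realType} (h : R -> R) (B s : R) :
  0 < s -> continuous h -> (forall x, B <= `|x| -> h x = 0) ->
  \int[@lebesgue_measure R]_(x in `]0, +oo[) h (x / s) =
  s * \int[@lebesgue_measure R]_(t in `]0, +oo[) h t.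
Proof.
move=> s0 ch h0.
pose b : R := `|B|.
have b0 : 0 <= b by exact: normr_ge0.
have hb (x : R) : b <= x -> h x = 0.
  by move=> bx; apply: h0; rewrite (le_trans (ler_norm B))// (le_trans bx)// ler_norm.
have chs : continuous (fun x : R => h (x / s)).
  by move=> x; apply: (@continuous_comp _ _ _ (fun y : R => y / s) h);
    [exact: mulrr_continuous|exact: ch].
have mh (g : R -> R) (A : set R) :
    continuous g -> measurable A -> measurable_fun A (EFin \o g).
  move=> cg mA; apply/measurable_EFinP; apply: measurable_funTS.
  exact: continuous_measurable_fun.
have suppE (g : R -> R) (c : R) :
    0 <= c -> continuous g -> (forall x : R, c <= x -> g x = 0) ->
    \int[@lebesgue_measure R]_(x in `]0, +oo[) g x =
    \int[@lebesgue_measure R]_(x in `[0, c]) g x.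
  move=> c0 cg g0; rewrite /Rintegral; congr fine.
  rewrite [RHS]integral_itv_bndoo; last exact: mh.
  apply: integral_support.
  - by move=> x /=; rewrite !in_itv/= andbT => /andP[].
  - move=> x /=; rewrite !in_itv/= andbT => -> /negP; rewrite -leNgt => bx.
    by rewrite g0.
rewrite (suppE _ (s * b))//; first last.
- by move=> x sx; apply: hb; rewrite ler_pdivlMr// mulrC.
- exact: mulr_ge0 (ltW s0) b0.
rewrite (suppE _ b)// -RintegralZl//; last first.
  apply: continuous_compact_integrable; first exact: segment_compact.
  exact: continuous_subspaceT.
rewrite /Rintegral; congr fine.
have dF : (fun t : R => s * t)^`()%classic = cst s.
  by apply/funext => t; rewrite derive1E deriveZ// derive_id scaler1.
have := @integration_by_substitution_increasing R (fun t : R => s * t)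
  (fun x : R => h (x / s)) 0 b b0.
rewrite mulr0 => ->.
- by apply: eq_integral => x _; rewrite !fctE /= dF (mulrC s x) mulfK ?gt_eqF// mulrC.
- by move=> x y _ _; rewrite ltr_pM2l.
- by rewrite dF => x _; exact: cst_continuous.
- by rewrite dF; exact: is_cvg_cst.
- by rewrite dF; exact: is_cvg_cst.
- split.
  + by move=> x _; exact: derivableZ.
  + by apply: cvg_at_right_filter; exact: mulrl_continuous.
  + by apply: cvg_at_left_filter; exact: mulrl_continuous.
- exact: continuous_subspaceT.
Qed.

(** The difference quotients in the plane and along the slice are the same function of [h]. This
    lets the fundamental theorem of calculus act on slices. *)
Lemma is_derive_dt {R : realType} (phi : R * R -> R) (t x : R) :
  derivable phi (t, x) ((1, 0) : R * R) ->
  is_derive t 1 (fun t' : R => phi (t', x)) (dt phi (t, x)).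
Proof.
have E : (fun h : R => h^-1 *: (phi (h *: (1, 0) + (t, x)) - phi (t, x))) =
    (fun h : R => h^-1 *: (phi (h *: 1 + t, x) - phi (t, x))).
  apply/funext => h; congr (_ *: (phi _ - _)).
  by congr pair; rewrite /= scaler0 add0r.
rewrite /derivable E => d; apply: DeriveDef; first exact: d.
by rewrite /dt /derive E.
Qed.

Lemma is_derive_dx {R : realType} (phi : R * R -> R) (t x : R) :
  derivable phi (t, x) ((0, 1) : R * R) ->
  is_derive x 1 (fun x' : R => phi (t, x')) (dx phi (t, x)).
Proof.
have E : (fun h : R => h^-1 *: (phi (h *: (0, 1) + (t, x)) - phi (t, x))) =
    (fun h : R => h^-1 *: (phi (t, h *: 1 + x) - phi (t, x))).
  apply/funext => h; congr (_ *: (phi _ - _)).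
  by congr pair; rewrite /= scaler0 add0r.
rewrite /derivable E => d; apply: DeriveDef; first exact: d.
by rewrite /dx /derive E.
Qed.

(** * Iterated integrals over plane regions *)

Lemma integrable_prod_patch {R : realType} (D : set (R * R)) (g : R * R -> R) :
  measurable (D : set (measurableTypeR R * measurableTypeR R)%type) ->
  (leb2 R).-integrable setT (EFin \o g) ->
  (leb2 R).-integrable setT (EFin \o (g \_ D)).
Proof.
move=> mD ig.
rewrite -restrict_EFin; apply: (integrable_mkcond _ mD).1.
by apply: integrableS ig.
Qed.

(** Fubini is applied on the whole plane to the extension of [g] by zero; the section of [D] then
    reappears as the domain of the inner integral. *)
Lemma Rintegral_xsection {R : realType} (D : set (R * R)) (g : R * R -> R)
    (h : R -> R) :
  measurable (D : set (measurableTypeR R * measurableTypeR R)%type) ->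
  (leb2 R).-integrable setT (EFin \o g) ->
  (forall t, \int[@lebesgue_measure R]_(x in [set x | D (t, x)]) (g (t, x))%:E =
    (h t)%:E)%E ->
  \int[leb2 R]_(z in D) g z = \int[@lebesgue_measure R]_t h t.
Proof.
move=> mD ig gh; rewrite Rintegral_mkcond /Rintegral; congr fine.
rewrite -[LHS]integral12_prod_meas1; last exact: integrable_prod_patch.
apply: eq_integral => t _; rewrite /fubini_F -gh [RHS]integral_mkcond.
apply: eq_integral => x _; rewrite !patchE.
have -> : (x \in [set x | D (t, x)]) = ((t, x) \in D).
  by apply/idP/idP => /set_mem/mem_set.
by case: ifPn.
Qed.

Lemma Rintegral_ysection {R : realType} (D : set (R * R)) (g : R * R -> R)
    (h : R -> R) :
  measurable (D : set (measurableTypeR R * measurableTypeR R)%type) ->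
  (leb2 R).-integrable setT (EFin \o g) ->
  (forall x, \int[@lebesgue_measure R]_(t in [set t | D (t, x)]) (g (t, x))%:E =
    (h x)%:E)%E ->
  \int[leb2 R]_(z in D) g z = \int[@lebesgue_measure R]_x h x.
Proof.
move=> mD ig gh; rewrite Rintegral_mkcond /Rintegral; congr fine.
rewrite -[LHS]integral21_prod_meas1; last exact: integrable_prod_patch.
apply: eq_integral => x _; rewrite /fubini_G -gh [RHS]integral_mkcond.
apply: eq_integral => t _; rewrite !patchE.
have -> : (t \in [set t | D (t, x)]) = ((t, x) \in D).
  by apply/idP/idP => /set_mem/mem_set.
by case: ifPn.
Qed.

Lemma integrable_compact_support1 {R : realType} (h : R -> R) (B : R) :
  continuous h -> (forall x, B <= `|x| -> h x = 0) ->
  (@lebesgue_measure R).-integrable setT (EFin \o h).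
Proof.
move=> ch h0.
have -> : EFin \o h = (EFin \o h) \_ `[- B, B].
  apply/funext => x; rewrite patchE; case: ifPn => //= /negP xB.
  rewrite h0// leNgt; apply/negP => xB'; apply: xB.
  by apply/mem_set; rewrite /= in_itv/= -ler_norml ltW.
apply: (integrable_mkcond _ _).1; first exact: measurable_itv.
apply: continuous_compact_integrable; first exact: segment_compact.
exact: continuous_subspaceT.
Qed.

(** A function constant on sectors is a constant plus one jump times the indicator of such a region
    per shock, so Gauss-Green is wanted only on these nested regions. *)
Definition right_of {R : realType} (s : R) : set (R * R) :=
  [set z | 0 < z.1 /\ s * z.1 < z.2].

Lemma measurable_half_plane (R : realType) :
  measurable (half_plane R : set (measurableTypeR R * measurableTypeR R)%type).
Proof.
apply: open_measurable_prod.
apply: (@open_comp _ _ (fst : R * R -> R) [set x | 0 < x]); last exact: open_gt.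
by move=> ? _; exact: cvg_fst.
Qed.

Lemma measurable_right_of {R : realType} (s : R) :
  measurable (right_of s : set (measurableTypeR R * measurableTypeR R)%type).
Proof.
have -> : right_of s =
    half_plane R `&` (fun z => z.2 - s * z.1) @^-1` [set x | 0 < x].
  by apply/funext => z; rewrite /right_of /= subr_gt0.
apply: measurableI; first exact: measurable_half_plane.
apply: open_measurable_prod.
apply: (@open_comp _ _ (fun z : R * R => z.2 - s * z.1) [set x | 0 < x]);
  last exact: open_gt.
move=> z _; apply: cvgB; first exact: cvg_snd.
by apply: cvgMr; exact: cvg_fst.
Qed.

(** * Integrals of the partial derivatives of a test function *)

Section gauss_green.
Context {R : realType} (phi : R * R -> R).
Hypothesis tphi : test_function setT phi.
Local Notation mu := (@lebesgue_measure R).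

Let class1 : class_C 1 phi. Proof. by case: tphi => /(_ 1%N). Qed.

Let cphi : continuous phi. Proof. by case: class1. Qed.

Let cdt : continuous (dt phi). Proof. by case: class1 => _ [_ _ []]. Qed.

Let cdx : continuous (dx phi). Proof. by case: class1 => _ [_ _ _ []]. Qed.

Let ddt (t x : R) : is_derive t 1 (fun t' : R => phi (t', x)) (dt phi (t, x)).
Proof. by apply: is_derive_dt; case: class1 => _ []. Qed.

Let ddx (t x : R) : is_derive x 1 (fun x' : R => phi (t, x')) (dx phi (t, x)).
Proof. by apply: is_derive_dx; case: class1 => _ []. Qed.

Let cslice_x (g : R * R -> R) (x : R) : continuous g -> continuous (fun t => g (t, x)).
Proof.
move=> cg t; apply: (@continuous_comp _ _ _ (fun t : R => (t, x)) g); last exact: cg.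
by apply: (cvg_pair (G := nbhs t) (H := nbhs x)); [exact: cvg_id|exact: cvg_cst].
Qed.

Let cslice_t (g : R * R -> R) (t : R) : continuous g -> continuous (fun x => g (t, x)).
Proof.
move=> cg x; apply: (@continuous_comp _ _ _ (fun x : R => (t, x)) g); last exact: cg.
by apply: (cvg_pair (G := nbhs t) (H := nbhs x)); [exact: cvg_cst|exact: cvg_id].
Qed.

Let cray (s : R) : continuous (fun t : R => phi (t, s * t)).
Proof.
move=> t; apply: (@continuous_comp _ _ _ (fun t : R => (t, s * t)) phi); last exact: cphi.
by apply: (cvg_pair (G := nbhs t) (H := nbhs (s * t)));
  [exact: cvg_id|exact: mulrl_continuous].
Qed.

(** With time as parameter, a jump across the line enters with the bare Rankine-Hugoniot factor,
    free of any arc length normalisation. *)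
Definition ray_integral (s : R) : R :=
  \int[mu]_(t in `]0, +oo[) phi (t, s * t).

(** Every region [right_of s] has this same half line as its base at [t = 0], so one trace serves
    all speeds. *)
Definition initial_integral : R := \int[mu]_(x in `]0, +oo[) phi (0, x).

Lemma integrable_dt : (leb2 R).-integrable setT (EFin \o dt phi).
Proof.
have [B _ hB] := test_function_support phi tphi.
by apply: (integrable_compact_support _ B cdt) => z /hB[].
Qed.

Lemma integrable_dx : (leb2 R).-integrable setT (EFin \o dx phi).
Proof.
have [B _ hB] := test_function_support phi tphi.
by apply: (integrable_compact_support _ B cdx) => z /hB[].
Qed.

Lemma integrable_ray (s : R) : mu.-integrable setT (EFin \o (fun t => phi (t, s * t))).
Proof.
have [B _ hB] := test_function_support phi tphi.
apply: (integrable_compact_support1 _ B (cray s)) => t tB.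
by case: (hB (t, s * t)) => //=; rewrite tB.
Qed.

Lemma integrable_initial : mu.-integrable setT (EFin \o (fun x => phi (0, x))).
Proof.
have [B _ hB] := test_function_support phi tphi.
apply: (integrable_compact_support1 _ B (cslice_t phi 0 cphi)) => x xB.
by case: (hB (0, x)) => //=; rewrite xB orbT.
Qed.

(** For fixed [t > 0] the section is the half line starting at [s * t], and [phi] vanishes far out
    on it. *)
Lemma Rintegral_dx_right_of (s : R) :
  \int[leb2 R]_(z in right_of s) dx phi z = - ray_integral s.
Proof.
have [B _ hB] := test_function_support phi tphi.
rewrite (@Rintegral_xsection _ _ _ ((fun t => - 1 * phi (t, s * t)) \_ `]0, +oo[)).
- rewrite -Rintegral_mkcond RintegralZl ?mulN1r//.
  by apply: integrableS (integrable_ray s).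
- exact: measurable_right_of.
- exact: integrable_dx.
move=> t; rewrite patchE.
case: ifPn => [/set_mem|/negP t0]; rewrite /right_of /=.
  rewrite in_itv/= andbT => t0.
  rewrite (_ : [set x | _] = `]s * t, +oo[%classic).
    rewrite mulN1r.
    apply: (@integral_derive1_oy _ (fun x => phi (t, x))
      (fun x => dx phi (t, x)) (ddx t) _ B).
    - exact: cslice_t.
    - by move=> x xB; case: (hB (t, x)) => //=; rewrite xB orbT.
  by apply/seteqP; split => x /=; rewrite in_itv/= andbT // => -[].
rewrite (_ : [set x | _] = set0) ?integral_set0//.
apply/seteqP; split => x //= -[t0' _]; apply: t0.
by apply/mem_set; rewrite /= in_itv/= t0'.
Qed.

Lemma Rintegral_dt_right_of (s : R) : 0 < s ->
  \int[leb2 R]_(z in right_of s) dt phi z = s * ray_integral s - initial_integral.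
Proof.
move=> s0.
have [B _ hB] := test_function_support phi tphi.
have hray x : B <= `|x| -> phi (x, s * x) = 0.
  by move=> xB; case: (hB (x, s * x)) => //=; rewrite xB.
have sx (x : R) : phi (x / s, x) = phi (x / s, s * (x / s)).
  by rewrite (mulrC s) divfK ?gt_eqF.
(* Integrating first in t, the line x = s t is met at t = x / s. *)
rewrite (@Rintegral_ysection _ _ _
    ((fun x => phi (x / s, x) - phi (0, x)) \_ `]0, +oo[)).
- rewrite -Rintegral_mkcond RintegralB//.
  + congr (_ - _); rewrite -(Rintegral_dilation (fun t => phi (t, s * t)) B)//.
    by apply: eq_Rintegral => x _; rewrite sx.
  + apply: integrableS (_ : mu.-integrable setT _) => //.
    (* The point has time coordinate [x / s], so the bound [B] in time becomes [s * |B|] in [x]. *)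
    apply: (integrable_compact_support1 _ (s * `|B|)).
      have -> : (fun x => phi (x / s, x)) =
          (fun t => phi (t, s * t)) \o (fun y : R => y / s).
        by apply/funext => y; exact: sx.
      by move=> x; apply: continuous_comp; [exact: mulrr_continuous|exact: cray].
    move=> x xB; rewrite sx hray// normrM normfV (gtr0_norm s0).
    by rewrite ler_pdivlMr// mulrC (le_trans _ xB)// ler_pM2l// ler_norm.
  + by apply: integrableS integrable_initial.
- exact: measurable_right_of.
- exact: integrable_dt.
move=> x; rewrite patchE.
case: ifPn => [/set_mem|/negP x0]; rewrite /right_of /=.
  rewrite in_itv/= andbT => x0.
  rewrite (_ : [set t | _] = `]0, x / s[%classic).
    apply: (@integral_derive1_oo _ (fun t => phi (t, x)) (fun t => dt phi (t, x))).
    - by move=> t; exact: ddt.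
    - exact: cslice_x.
    - by rewrite ltW// divr_gt0.
  apply/seteqP; split => t /=; rewrite in_itv/= ltr_pdivlMr// mulrC.
    by case => -> ->.
  by move=> /andP[].
rewrite (_ : [set t | _] = set0) ?integral_set0//.
apply/seteqP; split => t //= -[t0 st]; apply: x0.
by apply/mem_set; rewrite /= in_itv/= andbT (lt_trans _ st)// mulr_gt0.
Qed.

Lemma Rintegral_dx_half_plane :
  \int[leb2 R]_(z in half_plane R) dx phi z = 0.
Proof.
have [B _ hB] := test_function_support phi tphi.
rewrite (@Rintegral_xsection _ _ _ (cst 0)).
- by rewrite Rintegral_cst// mul0r.
- exact: measurable_half_plane.
- exact: integrable_dx.
move=> t; rewrite /half_plane /=.
have [t0|t0] := ltP 0 t; last by rewrite (_ : [set x | _] = set0) ?integral_set0// -subset0.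
rewrite (_ : [set x | _] = setT); last by rewrite -subTset.
apply: (@integral_derive1_line _ (fun x => phi (t, x))
  (fun x => dx phi (t, x)) (ddx t) _ B).
- exact: cslice_t.
- by move=> x xB; case: (hB (t, x)) => //=; rewrite xB orbT.
Qed.

Lemma Rintegral_dt_half_plane :
  \int[leb2 R]_(z in half_plane R) dt phi z = - \int[mu]_x phi (0, x).
Proof.
have [B _ hB] := test_function_support phi tphi.
rewrite (@Rintegral_ysection _ _ _ (fun x => - 1 * phi (0, x))).
- by rewrite RintegralZl ?mulN1r//; exact: integrable_initial.
- exact: measurable_half_plane.
- exact: integrable_dt.
move=> x; rewrite /half_plane /= mulN1r.
rewrite (_ : [set t | _] = `]0, +oo[%classic); last first.
  by apply/seteqP; split => t /=; rewrite in_itv/= andbT.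
apply: (@integral_derive1_oy _ (fun t => phi (t, x)) (fun t => dt phi (t, x)) _ _ B).
- by move=> t; exact: ddt.
- exact: cslice_x.
- by move=> t tB; case: (hB (t, x)) => //=; rewrite tB.
Qed.

End gauss_green.

Lemma restrictE {T : Type} {R : realType} (f : T -> R) (D : set T) z :
  (f \_ D) z = if z \in D then f z else 0.
Proof. by rewrite patchE. Qed.

(** * Two-shock solutions *)

(** On the half plane each non-strict test is exactly the negation of membership in [right_of], so
    the decomposition into jumps holds pointwise, shock lines included. *)
Definition three_states {R : realType} (uL uM uR s1 s2 : R) (z : R * R) : R :=
  if z.2 <= s1 * z.1 then uL else if z.2 <= s2 * z.1 then uM else uR.

Section three_states_integral.
Context {R : realType} (phi : R * R -> R).
Hypothesis tphi : test_function setT phi.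
Local Notation mu := (@lebesgue_measure R).

Let grad (a b : R) (z : R * R) : R := a * dt phi z + b * dx phi z.

Let integrable_grad (a b : R) (D : set (R * R)) :
  measurable (D : set (measurableTypeR R * measurableTypeR R)%type) ->
  (leb2 R).-integrable D (EFin \o grad a b).
Proof.
move=> mD; apply: (@integrableS _ _ _ _ setT) => //.
have [B _ hB] := test_function_support phi tphi.
have [_ [_ _ [cdt _] [cdx _]]] : class_C 1 phi by case: tphi => /(_ 1%N).
apply: (integrable_compact_support _ B).
  by move=> z; apply: cvgD; apply: cvgMr; [exact: cdt|exact: cdx].
by move=> z /hB[_ + +]; rewrite /grad => -> ->; rewrite !mulr0 addr0.
Qed.

Let Rintegral_grad (a b : R) (D : set (R * R)) :
  measurable (D : set (measurableTypeR R * measurableTypeR R)%type) ->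
  \int[leb2 R]_(z in D) grad a b z =
  a * \int[leb2 R]_(z in D) dt phi z + b * \int[leb2 R]_(z in D) dx phi z.
Proof.
move=> mD.
have idt : (leb2 R).-integrable D (EFin \o dt phi).
  by apply: integrableS (integrable_dt phi tphi).
have idx : (leb2 R).-integrable D (EFin \o dx phi).
  by apply: integrableS (integrable_dx phi tphi).
rewrite -!RintegralZl// -RintegralD//.
- have := integrable_grad a 0 D mD; congr (integrable _ _ _).
  by apply/funext => z; rewrite /grad /= mul0r addr0.
- have := integrable_grad 0 b D mD; congr (integrable _ _ _).
  by apply/funext => z; rewrite /grad /= mul0r add0r.
Qed.

Let Rintegral_grad_right_of (a b s : R) : 0 < s ->
  \int[leb2 R]_(z in half_plane R) (grad a b \_ (right_of s)) z =
  (a * s - b) * ray_integral phi s - a * initial_integral phi.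
Proof.
move=> s0; rewrite -Rintegral_mkcondr (_ : _ `&` _ = right_of s); last first.
  by apply/seteqP; split => z [].
rewrite Rintegral_grad; last exact: measurable_right_of.
rewrite Rintegral_dx_right_of// Rintegral_dt_right_of//.
ring.
Qed.

(** One formula for both uses: with [A = id] and [B = f] the coefficients of the ray integrals are
    the Rankine-Hugoniot defects, with [A = eta] and [B = q] they are the entropy dissipations of
    the two shocks. *)
Lemma Rintegral_three_states (A B : R -> R) (uL uM uR s1 s2 : R) :
  0 < s1 -> s1 < s2 ->
  let u := three_states uL uM uR s1 s2 in
  \int[leb2 R]_(z in half_plane R) (dt phi z * A (u z) + dx phi z * B (u z)) =
  - (A uL * \int[mu]_x phi (0, x)) - (A uR - A uL) * initial_integral phi
  + (s1 * (A uM - A uL) - (B uM - B uL)) * ray_integral phi s1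
  + (s2 * (A uR - A uM) - (B uR - B uM)) * ray_integral phi s2.
Proof.
move=> s10 s12 u; have s20 := lt_trans s10 s12.
pose G1 := grad (A uM - A uL) (B uM - B uL) \_ (right_of s1).
pose G2 := grad (A uR - A uM) (B uR - B uM) \_ (right_of s2).
have mH := measurable_half_plane R.
have iG (a b s : R) :
    (leb2 R).-integrable (half_plane R) (EFin \o (grad a b \_ (right_of s))).
  apply: (@integrableS _ _ _ _ setT) => //.
  apply: integrable_prod_patch; first exact: measurable_right_of.
  exact: integrable_grad.
transitivity (\int[leb2 R]_(z in half_plane R)
    (grad (A uL) (B uL) z + (G1 z + G2 z))).
  apply: eq_Rintegral => z /set_mem z0.
  rewrite /G1 /G2 !restrictE /grad.
  have rE s : (z \in right_of s) = (s * z.1 < z.2).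
    by apply/idP/idP => [/set_mem[]//|sz]; apply/mem_set.
  rewrite !rE !ltNge /u /three_states.
  (* As [z.1 > 0], the first ray lies left of the second, which makes the second of the four cases
     impossible. *)
  have s12z : s1 * z.1 < s2 * z.1 by rewrite ltr_pM2r.
  have [z1|z1] := leP z.2 (s1 * z.1); have [z2|z2] := leP z.2 (s2 * z.1) => /=.
  - ring.
  - by have := lt_trans z2 (le_lt_trans z1 s12z); rewrite ltxx.
  - ring.
  - ring.
rewrite RintegralD//; first last.
- rewrite (_ : _ \o _ = (EFin \o G1) \+ (EFin \o G2))%E//.
  by apply: integrableD => //; exact: iG.
- exact: integrable_grad.
rewrite RintegralD//; [|exact: iG..].
rewrite !Rintegral_grad_right_of// Rintegral_grad//.
rewrite Rintegral_dt_half_plane// Rintegral_dx_half_plane//.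
ring.
Qed.

End three_states_integral.

Lemma measurable_three_states {R : realType} (uL uM uR s1 s2 : R) :
  measurable_fun (half_plane R)
    (three_states uL uM uR s1 s2 : measurableTypeR R * measurableTypeR R -> R).
Proof.
have mle (s : R) : measurable_fun setT
    (fun z : measurableTypeR R * measurableTypeR R => z.2 <= s * z.1).
  apply: measurable_fun_ler; first exact: measurable_snd.
  apply: measurable_funM; first exact: measurable_cst.
  exact: measurable_fst.
apply: measurable_funTS.
apply: measurable_fun_if => //; first exact: mle.
apply: measurable_funTS.
by apply: measurable_fun_if => //; exact: mle.
Qed.

Lemma weak_solution_three_states {R : realType} (f : R -> R) (M uL uM uR s1 s2 : R) :
  0 < s1 -> s1 < s2 ->
  `|uL| <= M -> `|uM| <= M -> `|uR| <= M ->
  f uM - f uL = s1 * (uM - uL) -> f uR - f uM = s2 * (uR - uM) ->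
  weak_solution f M (riemann_data uL uR) (three_states uL uM uR s1 s2).
Proof.
move=> s10 s12 ML MM MR rh1 rh2; split.
- exact: measurable_three_states.
- by move=> z _; rewrite /three_states; case: ifP => // _; case: ifP.
move=> phi tphi.
rewrite (Rintegral_three_states phi tphi idfun f)//= rh1 rh2 !subrr !mul0r !addr0.
(* The Rankine-Hugoniot relations have removed the ray terms. What remains is the data, seen as [uL]
   plus a jump on the positive half line. *)
suff -> : \int[@lebesgue_measure R]_x (riemann_data uL uR x * phi (0, x)) =
    uL * \int[@lebesgue_measure R]_x phi (0, x) + (uR - uL) * initial_integral phi.
  by ring.
have i0 := integrable_initial phi tphi.
have i0' (D : set R) : measurable D ->
    (@lebesgue_measure R).-integrable D (EFin \o (fun x => phi (0, x))).
  by move=> mD; apply: integrableS i0.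
have iZ c (D : set R) : measurable D ->
    (@lebesgue_measure R).-integrable D (EFin \o (fun x => c * phi (0, x))).
  move=> mD; have := @integrableZl _ _ _ (@lebesgue_measure R) _ mD c _ (i0' D mD).
  by under eq_fun do rewrite -EFinM.
have i1 : (@lebesgue_measure R).-integrable setT
    (EFin \o ((fun x => (uR - uL) * phi (0, x)) \_ `[0, +oo[)).
  rewrite -restrict_EFin; apply: (integrable_mkcond _ _).1 => //.
  exact: iZ.
(* [riemann_data] equals [uR] at [0]; closing the half line there makes the integrands agree at
   every point. *)
rewrite /initial_integral Rintegral_itv_obnd_cbnd; last exact: i0'.
rewrite -!RintegralZl//; last exact: i0'.
rewrite [in X in _ = _ + X]Rintegral_mkcond -RintegralD//; last exact: iZ.
apply: eq_Rintegral => x _.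
have pE : ((fun x => (uR - uL) * phi (0, x)) \_ `[0, +oo[) x =
    if 0 <= x then (uR - uL) * phi (0, x) else 0.
  rewrite patchE (_ : (x \in _) = (0 <= x))//.
  by apply/idP/idP => [/set_mem|x0]; [|apply/mem_set]; rewrite /= in_itv/= andbT.
rewrite pE /riemann_data; case: ltP => x0; ring.
Qed.

(** A test function supported in the open half plane vanishes at [t = 0], so only the two
    dissipations remain, each times a nonnegative ray integral. *)
Lemma entropic_three_states {R : realType} (f eta q : R -> R) (uL uM uR s1 s2 : R) :
  entropy_flux f eta q -> 0 < s1 -> s1 < s2 ->
  0 <= s1 * (eta uM - eta uL) - (q uM - q uL) ->
  0 <= s2 * (eta uR - eta uM) - (q uR - q uM) ->
  entropic f eta (three_states uL uM uR s1 s2).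
Proof.
move=> fq s10 s12 e1 e2; exists q => // psi tpsi psi0.
have tpsi' : test_function setT psi by case: tpsi.
have psi00 x : psi (0, x) = 0.
  case: tpsi => _ _ sub; apply/eqP/negPn/negP => /= p0.
  suff : half_plane R (0, x) by rewrite /half_plane /= ltxx.
  exact/sub/subset_closure.
have ray0 s : 0 <= ray_integral psi s by apply: Rintegral_ge0.
rewrite (Rintegral_three_states psi tpsi' eta q)//.
rewrite /initial_integral.
have -> : (fun x : R => psi (0, x)) = cst 0 by apply/funext => x; exact: psi00.
rewrite !Rintegral_cst// !mul0r !mulr0 subr0 oppr0 add0r.
by rewrite addr_ge0// mulr_ge0.
Qed.

Lemma ae_eq_three_states {R : realType} (uL uR m m' s1 s2 s1' s2' : R) :
  0 < s1 -> s1 < s2 -> m != uL -> m != uR ->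
  ae_eq (leb2 R) (half_plane R) (three_states uL m uR s1 s2)
    (three_states uL m' uR s1' s2') -> m = m'.
Proof.
move=> s10 s12 mL mR [N [mN N0 subN]].
apply/eqP/negPn/negP => mm'.
(* Chosen so that [s1 * (1 + d)] is the midpoint [x0] of the speeds: then
   [s1 * t < x0 < x < s2 < s2 * t] on the box [Q], which thus lies in the middle sector. *)
pose d := (s2 - s1) / (2 * s1).
have d0 : 0 < d by rewrite divr_gt0 ?subr_gt0// mulr_gt0.
pose x0 := (s1 + s2) / 2.
have x0E : s1 * (1 + d) = x0.
  by rewrite /x0 /d; field; rewrite ?gt_eqF.
have x02 : x0 < s2 by rewrite /x0; lra.
pose Q : set (R * R) := `]1, 1 + d[ `*` `]x0, s2[.
have mI (u v : R) : measurable (`]u, v[%classic : set (measurableTypeR R)).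
  exact: measurable_itv.
(* On Q the first function equals m, a value that the second one never takes. *)
have QN : Q `<=` N.
  move=> [t x] [/=]; rewrite !in_itv/= => /andP[t1 td] /andP[xx0 xs2].
  apply: subN => /= /(_ _); rewrite /half_plane /= => H.
  have {H} := H (lt_trans ltr01 t1).
  rewrite /three_states /= leNgt (_ : s1 * t < x); last first.
    by rewrite (lt_trans _ xx0)// -x0E ltr_pM2l.
  rewrite (_ : x <= s2 * t) /=; last first.
    by rewrite (le_trans (ltW xs2))// ler_pMr ?(lt_trans s10)// ltW.
  by case: ifP => _; [|case: ifP => _]; apply/eqP.
have : (leb2 R Q <= leb2 R N)%E.
  by apply: le_measure; rewrite ?inE//; exact: measurableX.
rewrite N0 /Q /leb2/= product_measure1E; try exact: mI.
rewrite /= !lebesgue_measure_itv/= !lte_fin.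
by rewrite ltrDl d0 x02 !EFinN -!EFinD -EFinM lee_fin leNgt mulr_gt0// subr_gt0 // ltrDl.
Qed.

(** * The entropy u^2 + e^u *)

(** [113] is the least constant with which the estimate in [dissipation_left] closes. Applying
    [1 + x <= expR x] at [1 / 2] gives [(3 / 2) ^ 12 > 129]; unit steps would give only [2 ^ 6]. *)
Lemma expR6_ge (R : realType) : 113 <= expR (6 : R).
Proof.
have -> : (6 : R) = 12%:R * (1 / 2) by lra.
rewrite expRM_natl.
have h : (3 / 2 : R) <= expR (1 / 2) by have := expR_ge1Dx (1 / 2 : R); lra.
have : (3 / 2 : R) ^+ 12 <= expR (1 / 2) ^+ 12 by rewrite lerXn2r ?nnegrE ?expR_ge0//; lra.
apply: le_trans; lra.
Qed.

Definition flux {R : realType} (v : R) : R := v ^+ 3.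

Definition entropy {R : realType} (v : R) : R := v ^+ 2 + expR v.

(** An antiderivative of [(2 * v + expR v) * (3 * v ^ 2)]; two integrations by parts produce the
    factor of the exponential. *)
Definition flux_of_entropy {R : realType} (v : R) : R :=
  3 / 2 * v ^+ 4 + (3 * v ^+ 2 - 6 * v + 6) * expR v.

Lemma entropy_flux_of_entropy (R : realType) :
  entropy_flux (@flux R) entropy flux_of_entropy.
Proof.
move=> v.
have df : is_derive v 1 (@flux R) (3 * v ^+ 2).
  (* The same function up to conversion, written in the algebra of functions so that its derivative
     is inferred. *)
  suff : is_derive v 1 (id ^+ 3 : R -> R) (3 * v ^+ 2) by [].
  by apply: is_derive_eq; rewrite /= /GRing.scale/= mulr1.
have de : is_derive v 1 (@entropy R) (2 * v + expR v).
  suff : is_derive v 1 (id ^+ 2 + expR : R -> R) (2 * v + expR v) by [].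
  by apply: is_derive_eq; rewrite /= /GRing.scale/= mulr1 expr1.
have dq : is_derive v 1 (@flux_of_entropy R) (6 * v ^+ 3 + 3 * v ^+ 2 * expR v).
  suff : is_derive v 1 ((3 / 2) *: id ^+ 4 +
      (3 *: id ^+ 2 - 6 *: id + cst 6) * expR : R -> R)
      (6 * v ^+ 3 + 3 * v ^+ 2 * expR v) by [].
  apply: is_derive_eq; rewrite /= /GRing.scale/=.
  rewrite (_ : (_ + cst 6) v = 3 * v ^+ 2 - 6 * v + 6)//.
  by field.
split; first exact: ex_derive.
rewrite !derive1E !derive_val; ring.
Qed.

(** The part from [u^2] is negative for [m < -6]; the multiple of [expR 6] outweighs it, while
    [expR m] is at most [1]. *)
Lemma dissipation_left (R : realType) (m : R) : -8 <= m -> m <= - (15 / 2) ->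
  0 <= (36 + 6 * m + m ^+ 2) * (entropy m - entropy 6) -
       (flux_of_entropy m - flux_of_entropy 6).
Proof.
move=> m8 m7; rewrite /entropy /flux_of_entropy.
have Em1 : expR m <= 1 by rewrite expR_le1; lra.
have Em0 := expR_ge0 m.
have E6 := expR6_ge R.
move: (expR m) (expR 6) Em1 Em0 E6 => E E' Em1 Em0 E6.
have -> : (36 + 6 * m + m ^+ 2) * (m ^+ 2 + E - (6 ^+ 2 + E')) -
  (3 / 2 * m ^+ 4 + (3 * m ^+ 2 - 6 * m + 6) * E -
   (3 / 2 * 6 ^+ 4 + (3 * 6 ^+ 2 - 6 * 6 + 6) * E')) =
  (42 - 6 * m - m ^+ 2) * E' - (- (m + 6)) * (6 - m) ^+ 3 / 2
  - (2 * m ^+ 2 - 12 * m - 30) * E by field.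
(* Each polynomial is bounded by its value at the worst end [m = -8]; the total is then at least
   [26 * 113 - 14 ^ 3 - 194 = 0]. *)
have c6 : 26 <= 42 - 6 * m - m ^+ 2 by nra.
have cm : 2 * m ^+ 2 - 12 * m - 30 <= 194 by nra.
have cp : (6 - m) ^+ 3 <= 14 ^+ 3 by rewrite lerXn2r ?nnegrE//; lra.
have cp0 : 0 <= (6 - m) ^+ 3 by rewrite exprn_ge0//; lra.
have h1 : 26 * 113 <= (42 - 6 * m - m ^+ 2) * E' by rewrite ler_pM//; lra.
have h2 : (- (m + 6)) * (6 - m) ^+ 3 <= 2 * 14 ^+ 3 by rewrite ler_pM//; lra.
have h3 : (2 * m ^+ 2 - 12 * m - 30) * E <= 194 * 1 by rewrite ler_pM//; nra.
lra.
Qed.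

(** Here each term has the right sign: the coefficients of the exponentials factor as
    [(m - 1) * (m + 2)] and [(2 * m - 5) * (m - 1)], products of negative numbers. *)
Lemma dissipation_right (R : realType) (m : R) : -8 <= m -> m <= - (15 / 2) ->
  0 <= (1 + m + m ^+ 2) * (entropy 1 - entropy m) -
       (flux_of_entropy 1 - flux_of_entropy m).
Proof.
move=> m8 m7; rewrite /entropy /flux_of_entropy.
have Em0 := expR_ge0 m.
have E1 := expR_ge0 (1 : R).
move: (expR m) (expR 1) Em0 E1 => E E' Em0 E1.
have -> : (1 + m + m ^+ 2) * (1 ^+ 2 + E' - (m ^+ 2 + E)) -
  (3 / 2 * 1 ^+ 4 + (3 * 1 ^+ 2 - 6 * 1 + 6) * E' -
   (3 / 2 * m ^+ 4 + (3 * m ^+ 2 - 6 * m + 6) * E)) =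
  (- (m + 1)) * (1 - m) ^+ 3 / 2 + (m - 1) * (m + 2) * E'
  + (2 * m ^+ 2 - 7 * m + 5) * E by field.
have c1 : 0 <= (m - 1) * (m + 2) by nra.
have cm : 0 <= 2 * m ^+ 2 - 7 * m + 5 by nra.
have c3 : 0 <= - (m + 1) * (1 - m) ^+ 3.
  by apply: mulr_ge0; [|apply: exprn_ge0]; lra.
have := mulr_ge0 c1 E1; have := mulr_ge0 cm Em0; lra.
Qed.

Theorem theoremA1 (R : realType) :
  let f : R -> R := fun v => v ^+ 3 in
  let eta : R -> R := fun v => v ^+ 2 + expR v in
  exists uL uR : R, [/\ 0 < uL, 0 < uR &
    exists M : R,
      infinite_set [set ae_class u |
        u in entropic_solutions f eta M (riemann_data uL uR)]].
Proof.
move=> f eta; exists 6, 1; split => //; exists 8.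
(* Infinitely many states, decreasing from [-15/2] towards [-8], so that [8] bounds all values. *)
pose m (n : nat) : R := n.+1%:R^-1 / 2 - 8.
have m8 n : -8 <= m n.
  by rewrite /m -[leLHS]add0r lerD2r divr_ge0// invr_ge0 ler0n.
have m7 n : m n <= - (15 / 2).
  have : n.+1%:R^-1 <= 1 :> R by rewrite invf_le1 ?ltr0n// ler1n.
  by rewrite /m; move: (n.+1%:R^-1 : R) => y; lra.
have m_inj : injective m.
  move=> i j /addIr/divIf; rewrite pnatr_eq0 => /(_ isT)/invr_inj/eqP.
  by rewrite eqr_nat => /eqP[].
pose s1 n := 36 + 6 * m n + m n ^+ 2.
pose s2 n := 1 + m n + m n ^+ 2.
(* The first speed is [(m + 3) ^ 2 + 27], and the second exceeds it by [- 5 * (m + 7)]. *)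
have s10 n : 0 < s1 n by rewrite /s1; move: (m n) => x; have := sqr_ge0 (x + 3); nra.
have s12 n : s1 n < s2 n by rewrite /s1 /s2; have := m7 n; move: (m n) => x; lra.
pose u n := three_states 6 (m n) 1 (s1 n) (s2 n).
have u_sol n : entropic_solutions f eta 8 (riemann_data 6 1) (u n).
  split.
    apply: weak_solution_three_states => //.
    - by rewrite ger0_norm//; lra.
    - by rewrite ler_norml; have := m8 n; have := m7 n; lra.
    - by rewrite normr1; lra.
    - by rewrite /f /s1; ring.
    - by rewrite /f /s2; ring.
  apply: (@entropic_three_states _ _ _ flux_of_entropy) => //.
  - exact: entropy_flux_of_entropy.
  - exact: dissipation_left.
  - exact: dissipation_right.
(* Were there finitely many classes, their preimage under this injective map would be finite, yet it
   is all of [nat]. *)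
move=> /(finite_preimage (f := fun n => ae_class (u n))) fin.
apply: infinite_nat; apply: sub_finite_set (fin _).
  by move=> n _; exists (u n).
move=> i j _ _ uij; apply: m_inj.
apply: (@ae_eq_three_states R 6 1 _ _ (s1 i) (s2 i) (s1 j) (s2 j)) => //.
- by rewrite lt_eqF//; have := m7 i; lra.
- by rewrite lt_eqF//; have := m7 i; lra.
(* Equal classes share the member [u j]; its membership in the class of [u i] is the almost
   everywhere equality sought. *)
- have : ae_class (u j) (u j) by apply: ae_eq_refl.
  by rewrite -uij.
Qed.
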